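(* Let $X=X_1\times X_2$ and $Y=Y_1\times Y_2$ be products of Polish spaces, let $\mu\in\mathcal{P}(X)$, $\nu\in\mathcal{P}(Y)$, and let $c:X\times Y\to[0,\infty)$ be a lower semicontinuous separable cost function. Let $(f^{(1)},f^{(2)})$ be an optimal cardinal flow between $\mu$ and $\nu$, let $\zeta\in\mathcal{P}(Y_1\times X_2)$ be the pivot measure on which it glues, and let $f^{(1)}_{|(x_2,y_1)}\in\mathcal{P}(X_1)$ and $f^{(2)}_{|(x_2,y_1)}\in\mathcal{P}(Y_2)$ be the conditional laws of $f^{(1)}$ and $f^{(2)}$ given $(x_2,y_1)$ (with respect to $\zeta$). Then any measurable family of probability measures $\gamma_{(x_2,y_1)}$ on $X_1\times Y_2$ with $$\gamma_{(x_2,y_1)}\in\Pi\big(f^{(1)}_{|(x_2,y_1)},f^{(2)}_{|(x_2,y_1)}\big)$$ satisfies $$\gamma_{(x_2,y_1)}\otimes\zeta\in\Gamma_o(\mu,\nu).$$ In particular, the transportation plan $$\pi:=\big(f^{(1)}_{|(x_2,y_1)}\otimes f^{(2)}_{|(x_2,y_1)}\big)\otimes\zeta$$ minimizes $\pi'\mapsto\int_{X\times Y}c\,d\pi'$ over $\Pi(\mu,\nu)$.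
   Context: $\mathcal{P}(Z)$ denotes the Borel probability measures on a Polish space $Z$; $T_\#$ denotes push-forward; $\mathfrak{p}_A$ denotes the projection onto the factor(s) $A$. Points are written $\mathbf{x}=(x_1,x_2)$, $\mathbf{y}=(y_1,y_2)$. $\Pi(\alpha,\beta)$ is the set of probability measures on the product space with marginals $\alpha$ and $\beta$. $\Gamma_o(\mu,\nu)$ is the set of minimizers of $\pi\mapsto\int_{X\times Y}c\,d\pi$ over $\Pi(\mu,\nu)$. Separable cost: $c(\mathbf{x},\mathbf{y})=c_1(x_1,y_1)+c_2(x_2,y_2)$ with $c_1:X_1\times Y_1\to\mathbb{R}$, $c_2:X_2\times Y_2\to\mathbb{R}$. Cardinal flows: $\mathcal{F}(\mu,\nu)$ is the set of pairs $(f^{(1)},f^{(2)})\in\mathcal{P}(X\times Y_1)\times\mathcal{P}(X_2\times Y)$ such that $(\mathfrak{p}_X)_\#f^{(1)}=\mu$, $(\mathfrak{p}_Y)_\#f^{(2)}=\nu$ and $(\mathfrak{p}_{Y_1\times X_2})_\#f^{(1)}=(\mathfrak{p}_{Y_1\times X_2})_\#f^{(2)}$; the flow is said to glue on this common marginal. A cardinal flow is optimal if it minimizes $\mathbb{CT}_c(f^{(1)},f^{(2)})=\int_{X\times Y_1}c_1\,df^{(1)}+\int_{X_2\times Y}c_2\,df^{(2)}$ over $\mathcal{F}(\mu,\nu)$. A pivot measure is a measure on $Y_1\times X_2$ on which some optimal cardinal flow glues. Notation: for a measurable family $\gamma_{(x_2,y_1)}\in\mathcal{P}(X_1\times Y_2)$,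 $\gamma_{(x_2,y_1)}\otimes\zeta$ is the probability measure on $X\times Y$ (coordinates reordered as $(x_1,x_2,y_1,y_2)$) with $\int\phi\,d(\gamma_{(x_2,y_1)}\otimes\zeta)=\int_{Y_1\times X_2}\big(\int_{X_1\times Y_2}\phi(x_1,x_2,y_1,y_2)\,d\gamma_{(x_2,y_1)}(x_1,y_2)\big)d\zeta(y_1,x_2)$. The expression $f^{(1)}_{|(x_2,y_1)}\otimes f^{(2)}_{|(x_2,y_1)}$ is a product measure. *)

(* Defs.v *)
From HB Require Import structures.
From mathcomp Require Import all_boot all_order all_algebra.
From mathcomp Require Import all_classical all_reals all_analysis.
From mathcomp Require Import measurable_realfun giry.

Set Implicit Arguments.
Unset Strict Implicit.
Unset Printing Implicit Defensive.

Import Order.TTheory GRing.Theory Num.Theory.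
Import numFieldNormedType.Exports.

Local Open Scope classical_set_scope.
Local Open Scope ring_scope.
Local Open Scope ereal_scope.

Section polish.
Context (R : realType) (T : topologicalType).
Local Open Scope ring_scope.

Record is_metric (d : T -> T -> R) : Prop := IsMetric {
  metric_eq0 : forall x y, d x y = 0 <-> x = y ;
  metric_symm : forall x y, d x y = d y x ;
  metric_trian : forall x y z, d x z <= d x y + d y z }.

Definition metric_compatible (d : T -> T -> R) : Prop :=
  forall (x : T) (A : set T),
    nbhs x A <-> exists2 e : R, 0 < e & [set y | d x y < e] `<=` A.

Definition metric_complete (d : T -> T -> R) : Prop :=
  forall u : nat -> T,
    (forall e : R, 0 < e -> exists N : nat, forall m n : nat,
       (N <= m)%N -> (N <= n)%N -> d (u m) (u n) < e) ->
    exists l : T, u @ \oo --> l.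

Definition is_polish : Prop :=
  (exists d : T -> T -> R,
     [/\ is_metric d, metric_compatible d & metric_complete d]) /\
  (exists D : set T, countable D /\ dense D).

End polish.

(* The carrier of [borel T] is [T] itself.  Products of such types carry the
   product sigma-algebra, which for Polish factors is the Borel sigma-algebra
   of the product topology: see [measurable_borel_prod] and
   [measurable_borel_prod_prod] below. *)
Notation borel T := (g_sigma_algebraType (@open T)).

Section borel_product.
Context (R : realType).

Lemma polish_second_countable (T : topologicalType) :
  is_polish R T -> @second_countable T.
Proof.
move=> [[d [dm dc _]] [D [cD dD]]].
have dxx x : d x x = 0%R by exact/(metric_eq0 dm).
have dballo x e : open [set y | (d x y < e)%R].
  rewrite openE => y /= xye; apply/dc; exists (e - d x y)%R.
    by rewrite subr_gt0.
  move=> z /= yz; apply: le_lt_trans (metric_trian dm x y z) _.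
  by rewrite addrC -ltrBrDr.
pose B (p : T * nat) := [set y | (d p.1 y < p.2.+1%:R^-1)%R].
exists (B @` (D `*` [set: nat])).
  by apply: (card_le_trans (card_image_le _ _)); exact: countableX.
split=> [_ [p _ <-]|x A /dc[e e0 eA]]; first exact: dballo.
have [n ne] : exists n, (n.+1%:R^-1 < e / 2)%R.
  have e20 : (0 < e / 2)%R by rewrite divr_gt0.
  have [n _ /(_ n (leqnn n))] := near_infty_natSinv_lt (PosNum e20).
  by exists n.
have [y [/= xy Dy]] : [set y | (d x y < n.+1%:R^-1)%R] `&` D !=set0.
  by apply: dD; [exists x; rewrite /= dxx invr_gt0|exact: dballo].
exists (B (y, n)) => /=.
  by split; [exists (y, n)|rewrite /B /= (metric_symm dm)].
move=> z /= yz; apply: eA => /=.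
apply: le_lt_trans (metric_trian dm x y z) _.
rewrite [ltRHS]splitr; apply: ltrD; exact: lt_trans ne.
Qed.

Let rect (T U : topologicalType) (p : set T * set U) : set (T * U) :=
  p.1 `*` p.2.

Let rect_basis (T U : topologicalType) (BT : set (set T)) (BU : set (set U)) :
  basis BT -> basis BU -> basis (@rect T U @` (BT `*` BU)).
Proof.
move=> [oT bT] [oU bU]; split=> [_ [[P Q] /= [/oT oP /oU oQ] <-]|].
  rewrite openE => -[x y] [/= Px Qy]; exists (P, Q) => //=.
  by split; exact: open_nbhs_nbhs.
move=> [x y] A [[P Q] /= [/bT[P' [BP' P'x] P'P] /bU[Q' [BQ' Q'y] Q'Q]] PQA].
exists (P' `*` Q') => /=; first by split=> //; exists (P', Q').
by move=> [a b] [/= /P'P Pa /Q'Q Qb]; exact: PQA.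
Qed.

Lemma second_countable_prod (T U : topologicalType) :
  @second_countable T -> @second_countable U -> @second_countable (T * U)%type.
Proof.
move=> [BT cT bT] [BU cU bU]; exists (@rect T U @` (BT `*` BU)).
  by apply: (card_le_trans (card_image_le _ _)); exact: countableX.
exact: rect_basis.
Qed.

Lemma g_sigma_open_prod (T U : topologicalType) :
  @second_countable T -> @second_countable U ->
  <<s preimage_set_system setT (@fst T U) <<s open >> `|`
      preimage_set_system setT (@snd T U) <<s open >> >> =
  <<s @open (T * U)%type >>.
Proof.
move=> [BT cT bT] [BU cU bU]; apply/seteqP; split.
  apply: smallest_sub; first exact: smallest_sigma_algebra.
  have sub (V : topologicalType) (f : T * U -> V) : continuous f ->
      preimage_set_system setT f <<s open >> `<=` <<s open >>.
    move=> cf _ [A sA <-]; move: A sA; apply: smallest_sub.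
      by apply: sigma_algebra_image; exact: smallest_sigma_algebra.
    move=> A oA; apply: sub_sigma_algebra; rewrite setTI.
    by apply: open_comp => // z _; exact: cf.
  rewrite subUset; split; apply: sub.
  - by move=> z; exact: cvg_fst.
  - by move=> z; exact: cvg_snd.
apply: smallest_sub; first exact: smallest_sigma_algebra.
move=> O oO.
pose B := (@rect T U @` (BT `*` BU)).
have [BO bB] := rect_basis bT bU.
rewrite (_ : O = \bigcup_(V in [set V | B V /\ V `<=` O]) V); last first.
  apply/seteqP; split=> [z Oz|z [V [_ /= VO] /VO//]].
  have [V [BV Vz] VO] := bB z O (open_nbhs_nbhs (conj oO Oz)).
  by exists V.
set C := [set V | _].
have /countable_injP[f injf] : countable C.
  apply: (@sub_countable _ _ _ B); first by apply: subset_card_le => V [].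
  by apply: (card_le_trans (card_image_le _ _)); exact: countableX.
rewrite (_ : \bigcup_(V in C) V =
    \bigcup_n \bigcup_(V in [set V | C V /\ f V = n]) V); last first.
  apply/seteqP; split=> [z [V CV Vz]|z [n _ [V [CV _] Vz]]]; last by exists V.
  by exists (f V) => //; exists V.
apply: sigma_algebra_bigcup => n.
have [[V [CV fV]]|nC] := pselect (exists V, C V /\ f V = n); last first.
  rewrite (_ : \bigcup_(_ in _) _ = set0); first exact: sigma_algebra0.
  by rewrite -subset0 => z [V CV _]; apply: nC; exists V.
rewrite (_ : \bigcup_(_ in _) _ = V); last first.
  apply/seteqP; split=> [z [V' [CV' fV'] V'z]|z Vz]; last by exists V.
  by rewrite (injf V V') ?inE// fV.
case: CV => -[[P Q] /= [BP BQ] <-] _.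
rewrite /rect (_ : P `*` Q = (fst @^-1` P) `&` (snd @^-1` Q)) //.
set S := _ `|` _.
have sS : sigma_algebra setT <<s S >> by exact: smallest_sigma_algebra.
have SI A1 A2 : <<s S >> A1 -> <<s S >> A2 -> <<s S >> (A1 `&` A2).
  by case/(@sigma_algebraP _ setT _ (fun _ _ _ _ => Logic.I)) : sS => _ _ _; exact.
apply: SI; apply: sub_sigma_algebra.
- left; exists P; last by rewrite setTI.
  by apply: sub_sigma_algebra; exact: bT.1.
- right; exists Q; last by rewrite setTI.
  by apply: sub_sigma_algebra; exact: bU.1.
Qed.

Lemma measurable_borel_prod (T U : ptopologicalType) :
  is_polish R T -> is_polish R U ->
  @measurable _ (borel T * borel U)%type = <<s @open (T * U)%type >>.
Proof.
move=> /polish_second_countable cT /polish_second_countable cU.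
exact: g_sigma_open_prod.
Qed.

Lemma measurable_borel_prod_prod (T1 T2 U1 U2 : ptopologicalType) :
  is_polish R T1 -> is_polish R T2 -> is_polish R U1 -> is_polish R U2 ->
  @measurable _ ((borel T1 * borel T2) * (borel U1 * borel U2))%type =
  <<s @open ((T1 * T2) * (U1 * U2))%type >>.
Proof.
move=> pT1 pT2 pU1 pU2; rewrite -g_sigma_open_prod; last 2 first.
- by apply: second_countable_prod; exact: polish_second_countable.
- by apply: second_countable_prod; exact: polish_second_countable.
by rewrite -!measurable_borel_prod.
Qed.

End borel_product.

Section image.
Context d d' (T : measurableType d) (U : measurableType d') (R : realType).

(* Measures are total functions on sets, so that their equality is only
   required on measurable sets. *)
Definition has_image (m : {measure set T -> \bar R}) (f : T -> U)
    (m' : {measure set U -> \bar R}) : Prop :=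
  forall B, measurable B -> pushforward m f B = m' B.

End image.

Section transport.
Context d d' (T : measurableType d) (U : measurableType d') (R : realType).

Definition is_coupling (pi : {measure set (T * U) -> \bar R})
    (al : {measure set T -> \bar R}) (be : {measure set U -> \bar R}) : Prop :=
  has_image pi fst al /\ has_image pi snd be.

Definition transport_cost (c : T * U -> R)
    (pi : {measure set (T * U) -> \bar R}) : \bar R :=
  \int[pi]_z (c z)%:E.

Definition optimal_plan (al : probability T R) (be : probability U R)
    (c : T * U -> R) (pi : probability (T * U)%type R) : Prop :=
  is_coupling pi al be /\
  forall pi' : probability (T * U)%type R, is_coupling pi' al be ->
    transport_cost c pi <= transport_cost c pi'.

End transport.

Section kernels.
Context d d1 d2 (W : measurableType d) (S1 : measurableType d1)
  (S2 : measurableType d2) (R : realType).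

Section pker_at.
Variables (d0 : measure_display) (S : measurableType d0) (k : R.-pker W ~> S)
  (w : W).

(* [k w], equipped with its probability measure structure. *)
Definition pker_at : set S -> \bar R := k w.

HB.instance Definition _ := Measure.on pker_at.

Let pker_at_setT : pker_at setT = 1.
Proof. exact: prob_kernel. Qed.

HB.instance Definition _ :=
  Measure_isProbability.Build _ _ _ pker_at pker_at_setT.
End pker_at.

Section kprod.
Variables (k1 : R.-pker W ~> S1) (k2 : R.-pker W ~> S2).

Definition kprod (w : W) : {measure set (S1 * S2) -> \bar R} :=
  pker_at k1 w \x pker_at k2 w.

Let measurable_kprod A : measurable A ->
  measurable_fun setT (fun w => kprod w A).
Proof.
move=> mA.
have mpk d0 (S : measurableType d0) (k : R.-pker W ~> S) :
    measurable_fun setT (fun w => pker_at k w : giry S R).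
  apply: measurable_giry_codensity => // B mB; exact: measurable_kernel.
have /= := measurableT_comp (@measurable_giry_ev _ _ R _ mA)
  (measurableT_comp measurable_giry_prod
    (measurable_fun_pair (mpk _ _ k1) (mpk _ _ k2))).
exact.
Qed.

HB.instance Definition _ :=
  isKernel.Build _ _ W (S1 * S2)%type R kprod measurable_kprod.

Let kprod_setT w : kprod w setT = 1.
Proof. exact: probability_setT. Qed.

HB.instance Definition _ :=
  Kernel_isProbability.Build _ _ W (S1 * S2)%type R kprod kprod_setT.
End kprod.
End kernels.

Section glue.
Context e1 e2 e3 e4 (X1 : measurableType e1) (X2 : measurableType e2)
  (Y1 : measurableType e3) (Y2 : measurableType e4) (R : realType).
Variables (zeta : probability (Y1 * X2)%type R)
  (gam : R.-pker (Y1 * X2) ~> (X1 * Y2)%type).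

(* The measure on [(X1 * X2) * (Y1 * Y2)] under which [(y1, x2)] has law [zeta]
   and [(x1, y2)] has conditional law [gam (y1, x2)]. *)
Definition glue_along (A : set ((X1 * X2) * (Y1 * Y2))) : \bar R :=
  \int[zeta]_w gam w [set p | A ((p.1, w.2), (w.1, p.2))].

Let section_glue A (w : Y1 * X2) :
  [set p : X1 * Y2 | A ((p.1, w.2), (w.1, p.2))] =
  xsection [set q : (Y1 * X2) * (X1 * Y2) |
    A ((q.2.1, q.1.2), (q.1.1, q.2.2))] w.
Proof. by rewrite xsectionE. Qed.

Let measurable_glue_preimage A : measurable A ->
  measurable [set q : (Y1 * X2) * (X1 * Y2) |
    A ((q.2.1, q.1.2), (q.1.1, q.2.2))].
Proof.
move=> mA; rewrite -[X in measurable X]setTI.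
pose h (q : (Y1 * X2) * (X1 * Y2)) := ((q.2.1, q.1.2), (q.1.1, q.2.2)).
suff mh : measurable_fun setT h by exact: mh.
by apply: measurable_fun_pair; apply: measurable_fun_pair;
  apply: measurableT_comp.
Qed.

Let glue0 : glue_along set0 = 0.
Proof. by rewrite /glue_along integral0_eq// => w _; rewrite measure0. Qed.

Let glue_ge0 A : 0 <= glue_along A.
Proof. exact: integral_ge0. Qed.

Let glue_sigma_additive : semi_sigma_additive glue_along.
Proof.
move=> F mF tF mUF.
rewrite [X in _ --> X](_ : _ = \sum_(n <oo) glue_along (F n)).
  by apply/cvg_closeP; split; [exact: is_cvg_nneseries|rewrite closeE].
rewrite /glue_along -integral_nneseries//; last first.
  move=> n; under eq_fun do rewrite section_glue.
  apply: measurable_fun_xsection_finite_kernel.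
  by rewrite inE; exact: measurable_glue_preimage.
apply: eq_integral => w _; apply/esym/cvg_lim => //=.
rewrite (_ : [set p | _] =
    \bigcup_n [set p : X1 * Y2 | F n ((p.1, w.2), (w.1, p.2))])//.
apply: (@measure_sigma_additive _ _ _ (gam w)).
  move=> n; rewrite section_glue; apply: measurable_xsection.
  exact: measurable_glue_preimage.
by move=> m n _ _ [p [Fm Fn]]; apply: (tF m n) => //;
  exists ((p.1, w.2), (w.1, p.2)).
Qed.

HB.instance Definition _ :=
  isMeasure.Build _ _ _ glue_along glue0 glue_ge0 glue_sigma_additive.

Let glue_setT : glue_along setT = 1.
Proof.
rewrite /glue_along (eq_integral (cst 1)); last first.
  by move=> w _; rewrite -[RHS](@prob_kernel _ _ _ _ _ gam w).
by rewrite integral_cst//= mul1e probability_setT.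
Qed.

HB.instance Definition _ := Measure_isProbability.Build _ _ _ glue_along glue_setT.
End glue.

Definition separable_cost (R : realType) (X1 X2 Y1 Y2 : Type)
    (c1 : X1 * Y1 -> R) (c2 : X2 * Y2 -> R)
    (c : (X1 * X2) * (Y1 * Y2) -> R) : Prop :=
  forall x1 x2 y1 y2, c ((x1, x2), (y1, y2)) = (c1 (x1, y1) + c2 (x2, y2))%R.

Section cardinal_flows.
Context e1 e2 e3 e4 (X1 : measurableType e1) (X2 : measurableType e2)
  (Y1 : measurableType e3) (Y2 : measurableType e4) (R : realType).

Definition proj1_Y1X2 (z : (X1 * X2) * Y1) : Y1 * X2 := (z.2, z.1.2).

Definition proj2_Y1X2 (z : X2 * (Y1 * Y2)) : Y1 * X2 := (z.2.1, z.1).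

Variables (mu : probability (X1 * X2)%type R)
  (nu : probability (Y1 * Y2)%type R).

Definition cardinal_flow (f1 : probability ((X1 * X2) * Y1)%type R)
    (f2 : probability (X2 * (Y1 * Y2))%type R) : Prop :=
  [/\ has_image f1 fst mu, has_image f2 snd nu &
      forall B : set (Y1 * X2), measurable B ->
        pushforward f1 proj1_Y1X2 B = pushforward f2 proj2_Y1X2 B].

Definition glues_on (f1 : probability ((X1 * X2) * Y1)%type R)
    (f2 : probability (X2 * (Y1 * Y2))%type R)
    (zeta : probability (Y1 * X2)%type R) : Prop :=
  has_image f1 proj1_Y1X2 zeta /\ has_image f2 proj2_Y1X2 zeta.

(* When [c1 (x1, y1) + c2 (x2, y2)] is nonnegative and lower semicontinuous,
   fixing one pair of variables shows that [c1] and [c2] are lower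
   semicontinuous and bounded below, so both integrals below are well defined
   in ]-oo, +oo] and their sum is not an indeterminate form. *)
Definition flow_cost (c1 : X1 * Y1 -> R) (c2 : X2 * Y2 -> R)
    (f1 : probability ((X1 * X2) * Y1)%type R)
    (f2 : probability (X2 * (Y1 * Y2))%type R) : \bar R :=
  \int[f1]_z (c1 (z.1.1, z.2))%:E + \int[f2]_z (c2 (z.1, z.2.2))%:E.

Definition optimal_cardinal_flow (c1 : X1 * Y1 -> R) (c2 : X2 * Y2 -> R)
    (f1 : probability ((X1 * X2) * Y1)%type R)
    (f2 : probability (X2 * (Y1 * Y2))%type R) : Prop :=
  cardinal_flow f1 f2 /\
  forall f1' f2', cardinal_flow f1' f2' ->
    flow_cost c1 c2 f1 f2 <= flow_cost c1 c2 f1' f2'.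

(* [k1] (resp. [k2]) is a version of the conditional law of the remaining
   variable given [(y1, x2)], i.e. a disintegration of [f1] (resp. [f2]) with
   respect to [zeta]. *)
Definition conditional_law1 (f1 : probability ((X1 * X2) * Y1)%type R)
    (zeta : probability (Y1 * X2)%type R)
    (k1 : R.-pker (Y1 * X2) ~> X1) : Prop :=
  forall A, measurable A ->
    f1 A = \int[zeta]_w k1 w [set x1 | A ((x1, w.2), w.1)].

Definition conditional_law2 (f2 : probability (X2 * (Y1 * Y2))%type R)
    (zeta : probability (Y1 * X2)%type R)
    (k2 : R.-pker (Y1 * X2) ~> Y2) : Prop :=
  forall A, measurable A ->
    f2 A = \int[zeta]_w k2 w [set y2 | A (w.2, (w.1, y2))].

End cardinal_flows.

(* Main.v *)
(* A coupling pi' of mu and nu projects, by forgetting y2 resp. x1, onto a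
   cardinal flow whose flow cost is the transport cost of pi', because the cost
   is separable.  Conversely gluing along zeta with a family of couplings of the
   conditional laws yields a plan that projects onto (f1, f2) itself.  Hence the
   glued plan costs as much as the optimal flow, which costs no more than pi'. *)
Require Import Defs.
From HB Require Import structures.
From mathcomp Require Import all_boot all_order all_algebra.
From mathcomp Require Import all_classical all_reals all_analysis.
From mathcomp Require Import measurable_realfun lra.

Set Implicit Arguments.
Unset Strict Implicit.
Unset Printing Implicit Defensive.

Import Order.TTheory GRing.Theory Num.Theory.
Import numFieldNormedType.Exports.

Local Open Scope classical_set_scope.
Local Open Scope ring_scope.

(** * Additivity of the integral for functions bounded below *)

Section integral_bounded_below.
Context d (T : measurableType d) (R : realType) (P : probability T R).
Local Open Scope ereal_scope.

(* Unlike [integralD], this allows the integrals to be infinite. *)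
Lemma integralD_cst_bounded_below (h : T -> R) (a : R) :
  measurable_fun setT h -> (0 <= a)%R -> (forall t, (- a <= h t)%R) ->
  \int[P]_t (h t + a)%:E = \int[P]_t (h t)%:E + a%:E.
Proof.
move=> mh a0 ha; pose hE t : \bar R := (h t)%:E.
have mE : measurable_fun setT hE by exact/measurable_EFinP.
have mneg := measurable_funeneg mE; have mpos := measurable_funepos mE.
have inta : \int[P]_t (cst a%:E t) = a%:E.
  by rewrite integral_cst//= probability_setT mule1.
have nega t : hE^\- t <= a%:E.
  by rewrite funenegE -EFinN ge_max !lee_fin a0 andbT lerNl.
(* The negative part is at most [a] and [P] has mass one, so its integral is finite even if that of
   [h] is infinite. *)
have fn : \int[P]_t hE^\- t \is a fin_num.
  rewrite ge0_fin_numE ?integral_ge0//.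
  apply: (@le_lt_trans _ _ a%:E); last exact: ltry.
  by rewrite -[leRHS]inta; apply: ge0_le_integral.
(* Moving the negative part to the left leaves only nonnegative integrands, to which [ge0_integralD]
   applies; [fn] then allows it to be subtracted again. *)
have key : \int[P]_t (h t + a)%:E + \int[P]_t hE^\- t =
           \int[P]_t hE^\+ t + a%:E.
  rewrite -[in RHS]inta -!ge0_integralD//.
  - apply: eq_integral => t _.
    rewrite funeposE funenegE -EFinN -!EFin_max -!EFinD; congr EFin.
    rewrite addrAC; congr (_ + _)%R.
    by rewrite /Num.max/=; do 2 case: ltrP => ?; lra.
  - by move=> t _; rewrite lee_fin -lerBlDr sub0r.
  - by apply/measurable_EFinP; apply: measurable_funD.
by rewrite [in RHS]integralE addeAC -key addeK.
Qed.

(** Adding [a] to [g] and [b] to [h] reduces to nonnegative functions. The finite constant [a + b]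
    cancels on both sides, even when an integral is infinite. *)
Lemma integralD_bounded_below (g h : T -> R) (a b : R) :
  measurable_fun setT g -> measurable_fun setT h ->
  (0 <= a)%R -> (0 <= b)%R ->
  (forall t, (- a <= g t)%R) -> (forall t, (- b <= h t)%R) ->
  \int[P]_t (g t + h t)%:E = \int[P]_t (g t)%:E + \int[P]_t (h t)%:E.
Proof.
move=> mg mh a0 b0 ga hb.
rewrite -[LHS](@addeK R (a + b)%:E)// -[RHS](@addeK R (a + b)%:E)//; congr (_ - _).
rewrite -integralD_cst_bounded_below ?addr_ge0//; last 2 first.
- exact: measurable_funD.
- by move=> t; rewrite opprD lerD.
rewrite EFinD addeACA -!integralD_cst_bounded_below// -ge0_integralD//.
- by apply: eq_integral => t _; rewrite -EFinD addrACA.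
- by move=> t _; rewrite lee_fin -lerBlDr sub0r.
- by apply/measurable_EFinP; apply: measurable_funD.
- by move=> t _; rewrite lee_fin -lerBlDr sub0r.
- by apply/measurable_EFinP; apply: measurable_funD.
Qed.

End integral_bounded_below.

(** * Change of variables and measurability *)

(** The nonnegative case is the push-forward formula. Splitting into positive and negative parts
    gives the rest without integrability, since the integral is by definition the difference of
    these two integrals. *)
Lemma integral_has_image d d' (T : measurableType d) (U : measurableType d')
    (R : realType) (m : {measure set T -> \bar R}) (f : T -> U)
    (m' : {measure set U -> \bar R}) (h : U -> \bar R) :
  measurable_fun setT f -> has_image m f m' -> measurable_fun setT h ->
  (\int[m']_u h u = \int[m]_t h (f t))%E.
Proof.
move=> mf im mh.
have im_ge0 g : measurable_fun setT g -> (forall u, 0 <= g u)%E ->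
    (\int[m']_u g u = \int[m]_t g (f t))%E.
  move=> mg g0.
  rewrite -[RHS](ge0_integral_pushforward mf m measurableT mg)//.
  by apply: eq_measure_integral => A mA _; exact/esym/im.
rewrite integralE !im_ge0//; last 2 first.
- exact: measurable_funeneg.
- exact: measurable_funepos.
rewrite [RHS]integralE; congr (_ - _)%E; apply: eq_integral => t _.
- by rewrite !funeposE.
- by rewrite !funenegE.
Qed.

Lemma measurable_kernel_preimage d1 d2 d3 (W : measurableType d1)
    (S : measurableType d2) (T : measurableType d3) (R : realType)
    (k : R.-pker W ~> S) (g : W * S -> T) (A : set T) :
  measurable_fun setT g -> measurable A ->
  measurable_fun setT (fun w => k w [set s | A (g (w, s))]).
Proof.
move=> mg mA.
rewrite (_ : (fun w => _) = fun w => k w (xsection (g @^-1` A) w)).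
  apply: measurable_fun_xsection_finite_kernel.
  by rewrite inE -[X in measurable X]setTI; exact: mg.
by apply/funext => w; rewrite xsectionE.
Qed.

(** Open rays generate the Borel sets of the line, and their preimages are open. Polish factors make
    open sets of the product measurable for the product sigma-algebra. *)
Lemma lower_semicontinuous_borel_prod (R : realType) (T U : ptopologicalType)
    (f : T * U -> R) :
  is_polish R T -> is_polish R U -> lower_semicontinuous (EFin \o f) ->
  measurable_fun [set: borel T * borel U] f.
Proof.
move=> pT pU /lower_semicontinuousP lf.
apply: (measurability _ (RGenOInfty.measurableE R)) => //.
move=> _ [_ [a ->] <-]; rewrite setTI (measurable_borel_prod pT pU).
apply: sub_sigma_algebra; rewrite /= preimage_itvoy.
by have := lf a; congr open; apply/funext => x /=; rewrite lte_fin.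
Qed.

(** * Passing between transport plans and cardinal flows *)

Section forget.
Context e1 e2 e3 e4 (X1 : measurableType e1) (X2 : measurableType e2)
  (Y1 : measurableType e3) (Y2 : measurableType e4).

Definition forgetY2 (z : (X1 * X2) * (Y1 * Y2)) : (X1 * X2) * Y1 :=
  (z.1, z.2.1).

Definition forgetX1 (z : (X1 * X2) * (Y1 * Y2)) : X2 * (Y1 * Y2) :=
  (z.1.2, z.2).

Lemma measurable_forgetY2 : measurable_fun setT forgetY2.
Proof. by apply: measurable_fun_pair => //; apply: measurableT_comp. Qed.

Lemma measurable_forgetX1 : measurable_fun setT forgetX1.
Proof. by apply: measurable_fun_pair => //; apply: measurableT_comp. Qed.

HB.instance Definition _ := isMeasurableFun.Build _ _ _ _ _ measurable_forgetY2.
HB.instance Definition _ := isMeasurableFun.Build _ _ _ _ _ measurable_forgetX1.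

Context (R : realType).

(** Both images come from the same [pi], and [proj1_Y1X2] after [forgetY2] is the same map as
    [proj2_Y1X2] after [forgetX1], so the gluing condition holds by computation. *)
Lemma cardinal_flow_of_coupling (mu : probability (X1 * X2)%type R)
    (nu : probability (Y1 * Y2)%type R)
    (pi : probability ((X1 * X2) * (Y1 * Y2))%type R) :
  is_coupling pi mu nu ->
  cardinal_flow mu nu (distribution pi forgetY2) (distribution pi forgetX1).
Proof. by case. Qed.

Lemma coupling_of_cardinal_flow (mu : probability (X1 * X2)%type R)
    (nu : probability (Y1 * Y2)%type R)
    (pi : probability ((X1 * X2) * (Y1 * Y2))%type R) f1 f2 :
  cardinal_flow mu nu f1 f2 ->
  has_image pi forgetY2 f1 -> has_image pi forgetX1 f2 ->
  is_coupling pi mu nu.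
Proof.
move=> [f1mu f2nu _] pif1 pif2; split => B mB.
- rewrite -f1mu// /pushforward -pif1//.
  by rewrite -[X in measurable X]setTI; exact: measurable_fst.
- rewrite -f2nu// /pushforward -pif2//.
  by rewrite -[X in measurable X]setTI; exact: measurable_snd.
Qed.

(** Change of variables brings both flow integrals back to [pi], where they add up; the lower bounds
    permit this even at infinite cost. *)
Lemma transport_cost_flow_cost (c1 : X1 * Y1 -> R) (c2 : X2 * Y2 -> R)
    (c : (X1 * X2) * (Y1 * Y2) -> R) (a b : R)
    (pi : probability ((X1 * X2) * (Y1 * Y2))%type R)
    (f1 : probability ((X1 * X2) * Y1)%type R)
    (f2 : probability (X2 * (Y1 * Y2))%type R) :
  separable_cost c1 c2 c ->
  measurable_fun setT c1 -> measurable_fun setT c2 ->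
  0 <= a -> 0 <= b -> (forall z, - a <= c1 z) -> (forall z, - b <= c2 z) ->
  has_image pi forgetY2 f1 -> has_image pi forgetX1 f2 ->
  transport_cost c pi = flow_cost c1 c2 f1 f2.
Proof.
move=> sep mc1 mc2 a0 b0 c1a c2b pif1 pif2.
have mp1 : measurable_fun setT (fun z : (X1 * X2) * Y1 => c1 (z.1.1, z.2)).
  apply: (measurableT_comp mc1); apply: measurable_fun_pair => //.
  exact: measurableT_comp.
have mp2 : measurable_fun setT (fun z : X2 * (Y1 * Y2) => c2 (z.1, z.2.2)).
  apply: (measurableT_comp mc2); apply: measurable_fun_pair => //.
  exact: measurableT_comp.
rewrite /flow_cost (integral_has_image measurable_forgetY2 pif1); last first.
  exact/measurable_EFinP.
rewrite (integral_has_image measurable_forgetX1 pif2); last first.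
  exact/measurable_EFinP.
rewrite -(@integralD_bounded_below _ _ _ _ _ _ a b)//.
- by apply: eq_integral => -[[x1 x2] [y1 y2]] _; rewrite sep.
- exact: measurableT_comp mp1 measurable_forgetY2.
- exact: measurableT_comp mp2 measurable_forgetX1.
Qed.

Variables (zeta : probability (Y1 * X2)%type R)
  (gam : R.-pker (Y1 * X2) ~> (X1 * Y2)%type).

(** Once [y2] is forgotten, only the first marginal of [gam w] matters; it is [k1 w], and
    integrating [k1] against [zeta] rebuilds [f1]. *)
Lemma glue_along_forgetY2 (f1 : probability ((X1 * X2) * Y1)%type R)
    (k1 : R.-pker (Y1 * X2) ~> X1) :
  conditional_law1 f1 zeta k1 ->
  (\forall w \ae zeta, has_image (gam w) fst (k1 w)) ->
  has_image (glue_along zeta gam) forgetY2 f1.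
Proof.
move=> f1k1 gamk1 A mA; rewrite [RHS]f1k1//.
(* The integrands agree only almost everywhere, so each must be shown measurable. *)
apply: ge0_ae_eq_integral => //.
- apply: (@measurable_kernel_preimage _ _ _ _ _ _ _ gam
    (fun q => ((q.2.1, q.1.2), q.1.1))) => //.
  by apply: measurable_fun_pair; [apply: measurable_fun_pair|];
    apply: measurableT_comp.
- apply: (@measurable_kernel_preimage _ _ _ _ _ _ _ k1
    (fun q => ((q.2, q.1.2), q.1.1))) => //.
  by apply: measurable_fun_pair; [apply: measurable_fun_pair|];
    rewrite //; apply: measurableT_comp.
apply: filterS gamk1 => w gamk1 _; rewrite -gamk1//.
have mg : measurable_fun setT (fun x1 : X1 => ((x1, w.2), w.1)).
  by apply: measurable_fun_pair => //; exact: measurable_fun_pair.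
by rewrite -[X in measurable X]setTI; exact: mg.
Qed.

Lemma glue_along_forgetX1 (f2 : probability (X2 * (Y1 * Y2))%type R)
    (k2 : R.-pker (Y1 * X2) ~> Y2) :
  conditional_law2 f2 zeta k2 ->
  (\forall w \ae zeta, has_image (gam w) snd (k2 w)) ->
  has_image (glue_along zeta gam) forgetX1 f2.
Proof.
move=> f2k2 gamk2 A mA; rewrite [RHS]f2k2//.
apply: ge0_ae_eq_integral => //.
- apply: (@measurable_kernel_preimage _ _ _ _ _ _ _ gam
    (fun q => (q.1.2, (q.1.1, q.2.2)))) => //.
  by apply: measurable_fun_pair; [|apply: measurable_fun_pair];
    apply: measurableT_comp.
- apply: (@measurable_kernel_preimage _ _ _ _ _ _ _ k2
    (fun q => (q.1.2, (q.1.1, q.2)))) => //.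
  by apply: measurable_fun_pair; [|apply: measurable_fun_pair];
    rewrite //; apply: measurableT_comp.
apply: filterS gamk2 => w gamk2 _; rewrite -gamk2//.
have mg : measurable_fun setT (fun y2 : Y2 => (w.2, (w.1, y2))).
  by apply: measurable_fun_pair => //; exact: measurable_fun_pair.
by rewrite -[X in measurable X]setTI; exact: mg.
Qed.

(** Topology enters only through measurability and lower bounds of [c1] and [c2], so the argument
    runs on arbitrary measurable spaces. *)
Lemma optimal_plan_glue_along (mu : probability (X1 * X2)%type R)
    (nu : probability (Y1 * Y2)%type R)
    (c1 : X1 * Y1 -> R) (c2 : X2 * Y2 -> R) (c : (X1 * X2) * (Y1 * Y2) -> R)
    (a b : R)
    (f1 : probability ((X1 * X2) * Y1)%type R)
    (f2 : probability (X2 * (Y1 * Y2))%type R)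
    (k1 : R.-pker (Y1 * X2) ~> X1) (k2 : R.-pker (Y1 * X2) ~> Y2) :
  separable_cost c1 c2 c ->
  measurable_fun setT c1 -> measurable_fun setT c2 ->
  0 <= a -> 0 <= b -> (forall z, - a <= c1 z) -> (forall z, - b <= c2 z) ->
  optimal_cardinal_flow mu nu c1 c2 f1 f2 ->
  conditional_law1 f1 zeta k1 -> conditional_law2 f2 zeta k2 ->
  (\forall w \ae zeta, is_coupling (gam w) (k1 w) (k2 w)) ->
  optimal_plan mu nu c (glue_along zeta gam).
Proof.
move=> sep mc1 mc2 a0 b0 c1a c2b [flow_f fmin] f1k1 f2k2 gamk.
have im1 : has_image (glue_along zeta gam) forgetY2 f1.
  by apply: glue_along_forgetY2 f1k1 _; apply: filterS gamk => w [].
have im2 : has_image (glue_along zeta gam) forgetX1 f2.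
  by apply: glue_along_forgetX1 f2k2 _; apply: filterS gamk => w [].
split=> [|pi' cpi']; first exact: (coupling_of_cardinal_flow flow_f im1 im2).
have costE pi g1 g2 :=
  @transport_cost_flow_cost c1 c2 c a b pi g1 g2 sep mc1 mc2 a0 b0 c1a c2b.
rewrite (costE _ _ _ im1 im2).
rewrite (costE pi' (distribution pi' forgetY2) (distribution pi' forgetX1))//.
by apply: fmin; exact: cardinal_flow_of_coupling.
Qed.

End forget.

Lemma is_coupling_kprod d d1 d2 (W : measurableType d) (S1 : measurableType d1)
    (S2 : measurableType d2) (R : realType)
    (k1 : R.-pker W ~> S1) (k2 : R.-pker W ~> S2) (w : W) :
  is_coupling (kprod k1 k2 w) (k1 w) (k2 w).
Proof.
split=> B mB; rewrite /pushforward.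
- rewrite -setXT [LHS]product_measure1E//.
  by rewrite [X in (_ * X)%E](@probability_setT _ _ _ (pker_at k2 w)) mule1.
- rewrite -setTX [LHS]product_measure1E//.
  by rewrite [X in (X * _)%E](@probability_setT _ _ _ (pker_at k1 w)) mul1e.
Qed.

Lemma continuous_pair (T U V : topologicalType) (f : T -> U) (g : T -> V) :
  continuous f -> continuous g -> continuous (fun x => (f x, g x)).
Proof.
by move=> cf cg x; apply: (@cvg_pair _ _ _ (nbhs x)); [exact: cf|exact: cg].
Qed.

(** * Lower semicontinuity of the two summands of the cost *)

Section separable_lower_semicontinuous.
Context (R : realType) (X1 X2 Y1 Y2 : ptopologicalType).
Variables (c1 : X1 * Y1 -> R) (c2 : X2 * Y2 -> R)
  (c : (X1 * X2) * (Y1 * Y2) -> R).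
Hypothesis sep : separable_cost c1 c2 c.
Hypothesis lsc : lower_semicontinuous (EFin \o c).

Lemma separable_lsc1 : lower_semicontinuous (EFin \o c1).
Proof.
apply/lower_semicontinuousP => a.
(* Along this continuous slice [c] equals [c1] plus a constant, so superlevel sets of [c1] are
   preimages of those of [c]. *)
pose j (p : X1 * Y1) : (X1 * X2) * (Y1 * Y2) := ((p.1, point), (p.2, point)).
rewrite (_ : mkset _ =
    j @^-1` [set z | ((a + c2 (point, point))%:E < (EFin \o c) z)%E]); last first.
  by apply/seteqP; split=> -[x y] /=; rewrite !lte_fin sep ltrD2r.
apply: open_comp; last by move/lower_semicontinuousP : lsc; exact.
move=> p _; apply: continuous_pair; apply: continuous_pair => q;
  by [exact: cvg_fst|exact: cvg_snd|exact: cvg_cst].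
Qed.

Lemma separable_lsc2 : lower_semicontinuous (EFin \o c2).
Proof.
apply/lower_semicontinuousP => a.
pose j (p : X2 * Y2) : (X1 * X2) * (Y1 * Y2) := ((point, p.1), (point, p.2)).
rewrite (_ : mkset _ =
    j @^-1` [set z | ((c1 (point, point) + a)%:E < (EFin \o c) z)%E]); last first.
  by apply/seteqP; split=> -[x y] /=; rewrite !lte_fin sep ltrD2l.
apply: open_comp; last by move/lower_semicontinuousP : lsc; exact.
move=> p _; apply: continuous_pair; apply: continuous_pair => q;
  by [exact: cvg_fst|exact: cvg_snd|exact: cvg_cst].
Qed.

End separable_lower_semicontinuous.

Theorem lemma5 (R : realType) (X1 X2 Y1 Y2 : ptopologicalType)
  (hX1 : is_polish R X1) (hX2 : is_polish R X2)
  (hY1 : is_polish R Y1) (hY2 : is_polish R Y2)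
  (mu : probability (borel X1 * borel X2)%type R)
  (nu : probability (borel Y1 * borel Y2)%type R)
  (c1 : X1 * Y1 -> R) (c2 : X2 * Y2 -> R)
  (c : (X1 * X2) * (Y1 * Y2) -> R)
  (hsep : separable_cost c1 c2 c)
  (hc0 : forall z, 0 <= c z)
  (hlsc : lower_semicontinuous (fun z => (c z)%:E))
  (f1 : probability ((borel X1 * borel X2) * borel Y1)%type R)
  (f2 : probability (borel X2 * (borel Y1 * borel Y2))%type R)
  (hopt : optimal_cardinal_flow mu nu c1 c2 f1 f2)
  (zeta : probability (borel Y1 * borel X2)%type R)
  (hzeta : glues_on f1 f2 zeta)
  (k1 : R.-pker (borel Y1 * borel X2) ~> borel X1)
  (k2 : R.-pker (borel Y1 * borel X2) ~> borel Y2)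
  (hk1 : conditional_law1 f1 zeta k1)
  (hk2 : conditional_law2 f2 zeta k2) :
  (forall gam : R.-pker (borel Y1 * borel X2) ~> (borel X1 * borel Y2)%type,
     (\forall w \ae zeta, is_coupling (gam w) (k1 w) (k2 w)) ->
     optimal_plan mu nu c (glue_along zeta gam)) /\
  optimal_plan mu nu c (glue_along zeta (kprod k1 k2)).
Proof.
have mc1 : measurable_fun [set: borel X1 * borel Y1] c1.
  by apply: lower_semicontinuous_borel_prod => //; exact: separable_lsc1 hlsc.
have mc2 : measurable_fun [set: borel X2 * borel Y2] c2.
  by apply: lower_semicontinuous_borel_prod => //; exact: separable_lsc2 hlsc.
(* Nonnegativity of [c] on the slice through [point] bounds [c1] below by [- c2 (point, point)]; the
   absolute value makes the constant nonnegative, as the cost identity requires. *)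
have c1_ge z : - `|c2 (point, point)| <= c1 z.
  apply: (@le_trans _ _ (- c2 (point, point))); first by rewrite lerN2 ler_norm.
  by case: z => x y; rewrite -subr_ge0 opprK -hsep.
have c2_ge z : - `|c1 (point, point)| <= c2 z.
  apply: (@le_trans _ _ (- c1 (point, point))); first by rewrite lerN2 ler_norm.
  by case: z => x y; rewrite -subr_ge0 opprK addrC -hsep.
have opt (gam : R.-pker (borel Y1 * borel X2) ~> (borel X1 * borel Y2)%type) :
    (\forall w \ae zeta, is_coupling (gam w) (k1 w) (k2 w)) ->
    optimal_plan mu nu c (glue_along zeta gam).
  exact: (@optimal_plan_glue_along _ _ _ _ (borel X1) (borel X2) (borel Y1)
    (borel Y2) R zeta gam mu nu c1 c2 c _ _ f1 f2 k1 k2 hsep mc1 mc2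
    (normr_ge0 _) (normr_ge0 _) c1_ge c2_ge hopt hk1 hk2).
split; first exact: opt.
(* The product family couples the conditional laws at every [w], hence almost everywhere. *)
by apply: opt; apply: aeW => w; exact: is_coupling_kprod.
Qed.
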